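(* Let $(S,\lhd)$ be a self-similar structure of a semi-monoidal category $(\mathcal C,\otimes)$, and let $\mathfrak D$ be a diagram over $(\mathcal F_S,\Box)$ canonical for $\{\Box,\,t_{\_,\_,\_},\,\lhd_{\_},\,\star,\,\alpha,\,(\ )^{-1}\}$. Then $\Phi(\mathfrak D)$ is canonical for $\{\star,\alpha,(\ )^{-1}\}$, the following two conditions are equivalent, and if they hold then $\mathfrak D$ commutes: 1. The equivalence class $[\mathfrak D]$ of $\mathfrak D$ under self-similarity equivalence contains a diagram canonical for $\{\Box,\,t_{\_,\_,\_},\,(\ )^{-1}\}$. 2. $\Phi(\mathfrak D)$ is guaranteed to commute by MacLane's coherence theorem for associativity, applied to $(End(x),\star,\alpha)$.
   Context: A semi-monoidal category is a category $\mathcal C$ with a functor $\otimes:\mathcal C\times\mathcal C\to\mathcal C$ and natural isomorphisms $\tau_{X,Y,Z}:X\otimes(Y\otimes Z)\to(X\otimes Y)\otimes Z$ satisfying MacLane's pentagon condition; no unit object is assumed. Standing convention: every object $A$ of a semi-monoidal category is faithful, i.e. the functors $A\otimes\_$ and $\_\otimes A$ are faithful. A self-similar structure $(S,\lhd)$ of $\mathcal C$ consists of an object $S$ and an isomorphism $\lhd:S\otimes S\to S$, with inverse $\rhd=\lhd^{-1}$. Composition is written right to left. $\mathrm{Tree}$ is the set of non-empty binary trees over a symbol $x$: $x\in\mathrm{Tree}$, and $(u\Box v)\in\mathrm{Tree}$ for all $u,v\in\mathrm{Tree}$. Define $Inst(x)=S$, $Inst(p\Box q)=Inst(p)\otimes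 Inst(q)$. The semi-monoidal category $(\mathcal F_S,\Box,t)$ freely generated by $S$ has $Ob(\mathcal F_S)=\mathrm{Tree}$, $\mathcal F_S(u,v)=\mathcal C(Inst(u),Inst(v))$, composition inherited from $\mathcal C$, tensor $u\Box v$ on objects and $f\Box g=f\otimes g$ on arrows, and $t_{u,v,w}=\tau_{Inst(u),Inst(v),Inst(w)}$. The generalised code isomorphisms $\lhd_u\in\mathcal F_S(u,x)$ are given by $\lhd_x=1_S$, $\lhd_{x\Box x}=\lhd$, $\lhd_{u\Box v}=\lhd_{x\Box x}(\lhd_u\Box\lhd_v)$, with inverses $\rhd_u\in\mathcal F_S(x,u)$. $End(x)$ is the monoid $\mathcal F_S(x,x)$ as a one-object category; $\Phi:\mathcal F_S\to End(x)$ is the functor sending every object to $x$ and $f\in\mathcal F_S(a,b)$ to $\lhd_b f\rhd_a$. The operation $f\star g=\Phi(f\Box g)$ is a semi-monoidal tensor on $End(x)$ with associativity isomorphism $\alpha=\Phi(t_{x,x,x})$; $\star$ and $\alpha$ are also regarded as an operation on, and an element of, $\mathcal F_S(x,x)$. A diagram over a small category $\mathcal A$ is a directed graph $G$ with a compatible assignment of objects of $\mathcal A$ to vertices and arrows of $\mathcal A$ to edges; its image under a functor has the same underlying graph. A diagram is canonical for a class $\Gamma$ of operations and arrows when its edges are built inductively (from identities, by composition and the operations) from members of $\Gamma$. Diagrams $\mathfrak T,\mathfrak U$ over $\mathcal F_S$ with graphs $G,G'$ are self-similarity equivalent when there is a graph isomorphism $\eta:G\to G'$ such that for every edge $e:s\to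 t$ of $G$, $\mathfrak T(e)\,\rhd_{\mathfrak T(s)}\lhd_{\mathfrak U(\eta(s))}=\rhd_{\mathfrak T(t)}\lhd_{\mathfrak U(\eta(t))}\,\mathfrak U(\eta(e))$; this is an equivalence relation. Let $(\mathcal W,\Box)$ be the category with $Ob(\mathcal W)=\mathrm{Tree}$, a unique arrow $u\to v$ when $u$ and $v$ have the same number of leaves and none otherwise, and tensor $u\Box v$. MacLane's substitution functor $\mathcal W\mathrm{Sub}:(\mathcal W,\Box)\to(End(x),\star)$ is the strict semi-monoidal functor sending every object to $x$ and every arrow $a\Box(b\Box c)\to(a\Box b)\Box c$ to $\alpha$. A diagram over $End(x)$ is ''guaranteed to commute by MacLane's coherence theorem for associativity'' when it is of the form $\mathcal W\mathrm{Sub}(\mathfrak P)$ for some diagram $\mathfrak P$ over $\mathcal W$ (such a diagram commutes since all diagrams over $\mathcal W$ do). *)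

(* Defs.v *)
From mathcomp Require Import ssreflect ssrfun ssrbool eqtype ssrnat.

Set Implicit Arguments.
Unset Strict Implicit.
Unset Printing Implicit Defensive.

Record category := Category {
  ob :> Type;
  hom : ob -> ob -> Type;
  idm : forall a, hom a a;
  hcomp : forall a b c, hom b c -> hom a b -> hom a c;
  comp_idl : forall a b (f : hom a b), hcomp (idm b) f = f;
  comp_idr : forall a b (f : hom a b), hcomp f (idm a) = f;
  compA : forall a b c d (h : hom c d) (g : hom b c) (f : hom a b),
    hcomp h (hcomp g f) = hcomp (hcomp h g) f
}.

Arguments hom {_} _ _.
Arguments idm {_} _.
Arguments hcomp {_ _ _ _} _ _.

Notation "g ∘ f" := (hcomp g f) (at level 40, left associativity).

Record functor (A B : category) := Functor {
  fob :> A -> B;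
  fmap : forall a b, hom a b -> hom (fob a) (fob b);
  fmap_id : forall a, fmap (idm a) = idm (fob a);
  fmap_comp : forall a b c (g : hom b c) (f : hom a b),
    fmap (g ∘ f) = fmap g ∘ fmap f
}.

Arguments fmap {_ _} _ {_ _} _.

Definition inverse_arrows (A : category) (a b : A) (f : hom a b) (g : hom b a) :=
  g ∘ f = idm a /\ f ∘ g = idm b.

Record iso (A : category) (a b : A) := Iso {
  fwd :> hom a b;
  bwd : hom b a;
  isoP : inverse_arrows fwd bwd
}.

Arguments iso {_} _ _.

Lemma bwdK (A : category) (a b : A) (i : iso a b) : bwd i ∘ i = idm a.
Proof. by case: i => f g []. Qed.

Lemma fwdK (A : category) (a b : A) (i : iso a b) : i ∘ bwd i = idm b.
Proof. by case: i => f g []. Qed.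

Lemma iso_id_subproof (A : category) (a : A) : inverse_arrows (idm a) (idm a).
Proof. by split; rewrite comp_idl. Qed.

Definition iso_id (A : category) (a : A) : iso a a := Iso (iso_id_subproof a).

Lemma iso_comp_subproof (A : category) (a b c : A) (j : iso b c) (i : iso a b) :
  inverse_arrows (j ∘ i) (bwd i ∘ bwd j).
Proof.
split; first by rewrite compA -(compA (bwd i)) bwdK comp_idr bwdK.
by rewrite compA -(compA j) fwdK comp_idr fwdK.
Qed.

Definition iso_comp (A : category) (a b c : A) (j : iso b c) (i : iso a b) :
  iso a c := Iso (iso_comp_subproof j i).

Lemma iso_map_subproof (A B : category) (F : functor A B) (a b : A)
  (i : iso a b) : inverse_arrows (fmap F i) (fmap F (bwd i)).
Proof. by split; rewrite -fmap_comp ?bwdK ?fwdK fmap_id. Qed.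

Definition iso_map (A B : category) (F : functor A B) (a b : A) (i : iso a b) :
  iso (F a) (F b) := Iso (iso_map_subproof F i).

Record semi_monoidal := SemiMonoidal {
  cat :> category;
  tens : cat -> cat -> cat;
  tensm : forall a a' b b' : cat,
    hom a a' -> hom b b' -> hom (tens a b) (tens a' b');
  tensm_id : forall a b : cat, tensm (idm a) (idm b) = idm (tens a b);
  tensm_comp : forall (a a' a'' b b' b'' : cat)
      (f' : hom a' a'') (f : hom a a') (g' : hom b' b'') (g : hom b b'),
    tensm (f' ∘ f) (g' ∘ g) = tensm f' g' ∘ tensm f g;
  tau : forall a b c : cat, iso (tens a (tens b c)) (tens (tens a b) c);
  tau_natural : forall (a a' b b' c c' : cat)
      (f : hom a a') (g : hom b b') (h : hom c c'),
    tau a' b' c' ∘ tensm f (tensm g h) = tensm (tensm f g) h ∘ tau a b c;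
  pentagon : forall a b c d : cat,
    tau (tens a b) c d ∘ tau a b (tens c d)
    = tensm (tau a b c) (idm d) ∘ tau a (tens b c) d ∘ tensm (idm a) (tau b c d)
}.

Arguments tens {_} _ _.
Arguments tensm {_ _ _ _ _} _ _.
Arguments tau {_} _ _ _.

Notation "a ⊗ b" := (tens a b) (at level 38, left associativity).
Notation "f ⊠ g" := (tensm f g) (at level 38, left associativity).

Definition faithful_object (C : semi_monoidal) (a : C) :=
  (forall (b c : C) (f g : hom b c), idm a ⊠ f = idm a ⊠ g -> f = g) /\
  (forall (b c : C) (f g : hom b c), f ⊠ idm a = g ⊠ idm a -> f = g).

Lemma iso_tens_subproof (C : semi_monoidal) (a a' b b' : C)
  (i : iso a a') (j : iso b b') : inverse_arrows (i ⊠ j) (bwd i ⊠ bwd j).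
Proof. by split; rewrite -tensm_comp ?bwdK ?fwdK tensm_id. Qed.

Definition iso_tens (C : semi_monoidal) (a a' b b' : C)
  (i : iso a a') (j : iso b b') : iso (a ⊗ b) (a' ⊗ b') :=
  Iso (iso_tens_subproof i j).

Record self_similar (C : semi_monoidal) := SelfSimilar {
  ss_ob : C;
  ss_code : iso (ss_ob ⊗ ss_ob) ss_ob
}.

Record digraph := Digraph {
  vertex :> Type;
  edge : vertex -> vertex -> Type
}.

Arguments edge {_} _ _.

Record diagram (A : category) := Diagram {
  shape :> digraph;
  dob : shape -> A;
  darr : forall v w : shape, edge v w -> hom (dob v) (dob w)
}.

Arguments dob {_} _ _.
Arguments darr {_} _ {_ _} _.

Definition dimage (A B : category) (F : functor A B) (D : diagram A) :
  diagram B :=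
  @Diagram B (shape D) (fun v => F (dob D v)) (fun v w e => fmap F (darr D e)).

(* Empty paths are included: in a commuting diagram every closed path composes
   to an identity. *)
Inductive dpath (G : digraph) : G -> G -> Type :=
| path_nil v : dpath v v
| path_cons u v w : edge u v -> dpath v w -> dpath u w.

Fixpoint path_comp (A : category) (D : diagram A) (v w : D) (p : dpath v w) :
  hom (dob D v) (dob D w) :=
  match p with
  | path_nil v => idm (dob D v)
  | path_cons _ _ _ e q => path_comp q ∘ darr D e
  end.

Definition commutes (A : category) (D : diagram A) :=
  forall (v w : D) (p q : dpath v w), path_comp p = path_comp q.

Record digraph_iso (G G' : digraph) := DigraphIso {
  iso_vertex :> G -> G';
  iso_edge : forall v w : G, edge v w -> edge (iso_vertex v) (iso_vertex w);
  iso_vertex_bij : bijective iso_vertex;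
  iso_edge_bij : forall v w : G, bijective (@iso_edge v w)
}.

Arguments iso_edge {_ _} _ {_ _} _.

Definition edgewise (A : category)
  (P : forall a b : A, hom a b -> Prop) (D : diagram A) :=
  forall (v w : D) (e : edge v w), P _ _ (darr D e).

(* For [FS S], defined below, this is canonicity for □, t and inverses; for
   [EndX s] it is canonicity for ⋆, α and inverses. *)
Inductive canonical_arrow (C : semi_monoidal) :
  forall a b : C, hom a b -> Prop :=
| can_id a : canonical_arrow (idm a)
| can_comp a b c (g : hom b c) (f : hom a b) :
    canonical_arrow g -> canonical_arrow f -> canonical_arrow (g ∘ f)
| can_tens a a' b b' (f : hom a a') (g : hom b b') :
    canonical_arrow f -> canonical_arrow g -> canonical_arrow (f ⊠ g)
| can_tau a b c : canonical_arrow (tau a b c)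
| can_inv a b (f : hom a b) (g : hom b a) :
    inverse_arrows f g -> canonical_arrow f -> canonical_arrow g.

Definition canonical (C : semi_monoidal) (D : diagram C) :=
  edgewise (@canonical_arrow C) D.

Inductive tree := leaf | node of tree & tree.

Fixpoint Inst (C : semi_monoidal) (S : C) (u : tree) : C :=
  match u with
  | leaf => S
  | node p q => Inst S p ⊗ Inst S q
  end.

Section Free.

Variables (C : semi_monoidal) (S : C).

Definition FS_cat : category :=
  @Category tree (fun u v => hom (Inst S u) (Inst S v))
    (fun u => idm (Inst S u)) (fun u v w g f => g ∘ f)
    (fun u v => @comp_idl C _ _) (fun u v => @comp_idr C _ _)
    (fun u v w z => @compA C _ _ _ _).

Definition FS_tau (u v w : FS_cat) :
  @iso FS_cat (node u (node v w)) (node (node u v) w) :=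
  let t := tau (Inst S u) (Inst S v) (Inst S w) in
  @Iso FS_cat (node u (node v w)) (node (node u v) w) (fwd t) (bwd t) (isoP t).

Definition FS : semi_monoidal :=
  @SemiMonoidal FS_cat node (fun u u' v v' f g => f ⊠ g)
    (fun u v => @tensm_id C _ _)
    (fun u u' u'' v v' v'' => @tensm_comp C _ _ _ _ _ _)
    FS_tau
    (fun u u' v v' w w' => @tau_natural C _ _ _ _ _ _)
    (fun u v w z => @pentagon C _ _ _ _).

End Free.

Section SelfSimilarity.

Variables (C : semi_monoidal) (s : self_similar C).

Local Notation F := (FS (ss_ob s)).
Local Notation one := (@idm F leaf).

Definition code_xx : @iso F (node leaf leaf) leaf :=
  @Iso F (node leaf leaf) leaf (ss_code s) (bwd (ss_code s)) (isoP (ss_code s)).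

Fixpoint code (u : tree) : @iso F u leaf :=
  match u with
  | leaf => @iso_id F leaf
  | node p q => iso_comp code_xx (@iso_tens F _ _ _ _ (code p) (code q))
  end.

Lemma code_node_leaf : fwd (code (node leaf leaf)) = code_xx.
Proof. by rewrite /= (@tensm_id C) (@comp_idr C). Qed.

Definition EndX_cat : category :=
  @Category unit (fun _ _ => @hom F leaf leaf)
    (fun _ => @idm F leaf) (fun _ _ _ g f => @hcomp F leaf leaf leaf g f)
    (fun _ _ => @comp_idl F _ _) (fun _ _ => @comp_idr F _ _)
    (fun _ _ _ _ => @compA F _ _ _ _).

Definition Phi_map (a b : F) (f : hom a b) : @hom F leaf leaf :=
  code b ∘ f ∘ bwd (code a).

Lemma Phi_map_id (a : F) : Phi_map (idm a) = one.
Proof. by rewrite /Phi_map comp_idr fwdK. Qed.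

Lemma Phi_map_comp (a b c : F) (g : hom b c) (f : hom a b) :
  Phi_map (g ∘ f) = Phi_map g ∘ Phi_map f.
Proof.
by rewrite /Phi_map !compA -(compA _ (bwd (code b))) bwdK comp_idr.
Qed.

Definition Phi : functor F EndX_cat :=
  @Functor F EndX_cat (fun _ => tt) Phi_map Phi_map_id Phi_map_comp.

Definition star (f g : @hom F leaf leaf) : @hom F leaf leaf :=
  Phi_map (f ⊠ g).

Definition alpha : @iso F leaf leaf :=
  let a := iso_map Phi (@tau F leaf leaf leaf) in
  @Iso F leaf leaf (fwd a) (bwd a) (isoP a).

Lemma Phi_leaf (f : @hom F leaf leaf) : Phi_map f = f.
Proof. by rewrite /Phi_map comp_idr comp_idl. Qed.

Lemma Phi_tens (a a' b b' : F) (f : hom a a') (g : hom b b') :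
  Phi_map (f ⊠ g) = star (Phi_map f) (Phi_map g).
Proof.
have code_nn : forall p q : F,
    code (node p q) = code (node leaf leaf) ∘ (code p ⊠ code q) :> hom _ _.
  by move=> p q; rewrite code_node_leaf.
have decode_nn : forall p q : F, bwd (code (node p q))
    = (bwd (code p) ⊠ bwd (code q)) ∘ bwd (code (node leaf leaf)) :> hom _ _.
  by move=> p q /=; rewrite (@tensm_id C) (@comp_idl C).
rewrite /star {1}/Phi_map code_nn decode_nn /Phi_map.
by rewrite !tensm_comp !compA.
Qed.

Lemma star_id : star one one = one.
Proof. by rewrite /star tensm_id Phi_map_id. Qed.

Lemma Phi_tau (a b c : F) : Phi_map (tau a b c) = alpha.
Proof.
have nat := tau_natural (s := F) (code a) (code b) (code c).
have E : Phi_map (@tau F leaf leaf leaf ∘ (fwd (code a) ⊠ (fwd (code b) ⊠ fwd (code c))))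
       = Phi_map (((fwd (code a) ⊠ fwd (code b)) ⊠ fwd (code c)) ∘ tau a b c).
  by rewrite nat.
have Phi_code : forall u : F, Phi_map (fwd (code u)) = one.
  by move=> u; rewrite /Phi_map comp_idl fwdK.
move: E; rewrite !Phi_map_comp !Phi_tens !Phi_code !star_id.
by rewrite comp_idr comp_idl => <-.
Qed.

Lemma star_comp (f' f g' g : @hom F leaf leaf) :
  star (f' ∘ f) (g' ∘ g) = star f' g' ∘ star f g.
Proof. by rewrite /star tensm_comp Phi_map_comp. Qed.

Lemma alpha_natural (f g h : @hom F leaf leaf) :
  alpha ∘ star f (star g h) = star (star f g) h ∘ alpha.
Proof.
rewrite -(Phi_tau leaf leaf leaf) -{1}(Phi_leaf f) -{2}(Phi_leaf h).
by rewrite -!Phi_tens -!Phi_map_comp tau_natural.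
Qed.

Lemma alpha_pentagon :
  alpha ∘ alpha
  = star alpha one ∘ alpha ∘ star one alpha :> @hom F leaf leaf.
Proof.
rewrite -{1}(Phi_tau (node leaf leaf) leaf leaf).
rewrite -{1}(Phi_tau leaf leaf (node leaf leaf)) -Phi_map_comp pentagon.
by rewrite !Phi_map_comp !Phi_tens !Phi_tau !Phi_map_id.
Qed.

Definition EndX_alpha (a b c : EndX_cat) : @iso EndX_cat tt tt :=
  @Iso EndX_cat tt tt alpha (bwd alpha) (isoP alpha).

Definition EndX : semi_monoidal :=
  @SemiMonoidal EndX_cat (fun _ _ => tt) (fun _ _ _ _ f g => star f g)
    (fun _ _ => star_id) (fun _ _ _ _ _ _ => star_comp)
    EndX_alpha
    (fun _ _ _ _ _ _ => alpha_natural) (fun _ _ _ _ => alpha_pentagon).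

(* Canonicity over [F] for □, t, the code isomorphisms, ⋆, α and inverses. *)
Inductive code_canonical_arrow : forall a b : F, hom a b -> Prop :=
| ccan_id a : @code_canonical_arrow a a (idm a)
| ccan_comp a b c (g : @hom F b c) (f : @hom F a b) :
    code_canonical_arrow g -> code_canonical_arrow f ->
    code_canonical_arrow (g ∘ f)
| ccan_tens a a' b b' (f : @hom F a a') (g : @hom F b b') :
    code_canonical_arrow f -> code_canonical_arrow g ->
    @code_canonical_arrow (a ⊗ b) (a' ⊗ b') (f ⊠ g)
| ccan_tau a b c :
    @code_canonical_arrow (a ⊗ (b ⊗ c)) ((a ⊗ b) ⊗ c) (tau a b c)
| ccan_code a : @code_canonical_arrow a leaf (code a)
| ccan_star f g :
    @code_canonical_arrow leaf leaf f -> @code_canonical_arrow leaf leaf g ->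
    @code_canonical_arrow leaf leaf (star f g)
| ccan_alpha : @code_canonical_arrow leaf leaf alpha
| ccan_inv a b (f : @hom F a b) (g : @hom F b a) :
    inverse_arrows f g -> code_canonical_arrow f -> code_canonical_arrow g.

Definition code_canonical (D : diagram F) := edgewise code_canonical_arrow D.

Definition ss_equiv (T U : diagram F) :=
  exists eta : digraph_iso T U, forall (v w : T) (e : edge v w),
    darr T e ∘ (bwd (code (dob T v)) ∘ code (dob U (eta v)))
    = bwd (code (dob T w)) ∘ code (dob U (eta w)) ∘ darr U (iso_edge eta e).

End SelfSimilarity.

Fixpoint leaves (u : tree) : nat :=
  match u with
  | leaf => 1
  | node p q => leaves p + leaves q
  end.

Fixpoint left_tree (n : nat) : tree :=
  if n is m.+1 then node (left_tree m) leaf else leaf.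

Section Coherence.

Variables (A : category) (x : A).
Variables (st : hom x x -> hom x x -> hom x x) (al : hom x x).
Hypothesis st_id : st (idm x) (idm x) = idm x.
Hypothesis st_comp : forall f' f g' g : hom x x,
  st (f' ∘ f) (g' ∘ g) = st f' g' ∘ st f g.
Hypothesis al_natural : forall f g h : hom x x,
  al ∘ st f (st g h) = st (st f g) h ∘ al.
Hypothesis al_pentagon : al ∘ al = st al (idm x) ∘ al ∘ st (idm x) al.
Variables G L : tree -> hom x x.
Hypothesis G_leaf : G leaf = idm x.
Hypothesis G_node : forall p q, G (node p q) = G q ∘ (st (G p) (idm x) ∘ al).
Hypothesis L_leaf : L leaf = idm x.
Hypothesis L_node : forall p q, L (node p q) = G q ∘ st (L p) (idm x).

Let stL (f g : hom x x) : st (f ∘ g) (idm x) = st f (idm x) ∘ st g (idm x).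
Proof. by rewrite -st_comp comp_idl. Qed.

Let stR (f g : hom x x) : st (idm x) (f ∘ g) = st (idm x) f ∘ st (idm x) g.
Proof. by rewrite -st_comp comp_idl. Qed.

Lemma coherence_assoc u v w : L (node u (node v w)) = L (node (node u v) w) ∘ al.
Proof.
rewrite !L_node G_node !stL -!compA; do 2 congr (_ ∘ _).
by rewrite -{1}st_id al_natural.
Qed.

Let G_assoc n w : G (left_tree (n + leaves w)) ∘ st (idm x) (G w)
  = G w ∘ (st (G (left_tree n)) (idm x) ∘ al).
Proof.
elim: w n => [|p IHp q IHq] n.
  by rewrite addn1 /= G_node G_leaf st_id comp_idr comp_idl.
rewrite [leaves _]/= addnA G_node !stR !compA IHq -!compA; congr (_ ∘ _).
rewrite (compA al) al_natural -!compA compA -stL IHp !stL -!compA.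
congr (_ ∘ _); rewrite (compA (st al _)) -al_pentagon !compA.
by congr (_ ∘ _); rewrite -al_natural st_id.
Qed.

Let G_left u : G u = G (left_tree (leaves u).-1) ∘ st (idm x) (L u).
Proof.
have leaves_gt0 v : 0 < leaves v.
  by elim: v => //= p IHp q _; rewrite addn_gt0 IHp.
elim: u => [|v IHv w _]; first by rewrite L_leaf st_id comp_idr.
have -> : (leaves (node v w)).-1 = (leaves v).-1 + leaves w.
  by rewrite /=; case: (leaves v) (leaves_gt0 v).
rewrite L_node stR compA G_assoc G_node [in LHS]IHv stL -!compA.
by rewrite al_natural.
Qed.

Lemma coherence_tens u v u' v' (iu iv : hom x x) :
  leaves v = leaves v' -> L u' ∘ iu = idm x -> L v' ∘ iv = idm x ->
  L (node u v) = L (node u' v') ∘ st (iu ∘ L u) (iv ∘ L v).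
Proof.
move=> eqv Lu Lv.
rewrite !L_node -compA -st_comp comp_idl compA Lu comp_idl.
rewrite G_left [in RHS]G_left -!compA -!st_comp !comp_idl comp_idr.
by rewrite compA Lv comp_idl eqv.
Qed.

End Coherence.

Definition W_cat : category :=
  @Category tree (fun u v => leaves u = leaves v)
    (fun u => erefl) (fun u v w g f => etrans f g)
    (fun u v f => eq_irrelevance _ _) (fun u v f => eq_irrelevance _ _)
    (fun u v w z h g f => eq_irrelevance _ _).

Definition W_tau (u v w : W_cat) :
  @iso W_cat (node u (node v w)) (node (node u v) w) :=
  @Iso W_cat (node u (node v w)) (node (node u v) w)
    (addnA _ _ _) (esym (addnA _ _ _))
    (conj (eq_irrelevance _ _) (eq_irrelevance _ _)).

Definition W : semi_monoidal :=
  @SemiMonoidal W_cat node (fun u u' v v' f g => f_equal2 addn f g)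
    (fun _ _ => eq_irrelevance _ _) (fun _ _ _ _ _ _ _ _ _ _ => eq_irrelevance _ _)
    W_tau
    (fun _ _ _ _ _ _ _ _ _ => eq_irrelevance _ _)
    (fun _ _ _ _ => eq_irrelevance _ _).

Section Substitution.

Variables (C : semi_monoidal) (s : self_similar C).

Local Notation F := (FS (ss_ob s)).
Local Notation one := (@idm F leaf).
Local Notation al := (alpha s).

Lemma star_iso_subproof (i j : @iso F leaf leaf) :
  inverse_arrows (star i j) (star (bwd i) (bwd j)).
Proof. by split; rewrite -star_comp ?bwdK ?fwdK star_id. Qed.

Definition star_iso (i j : @iso F leaf leaf) : @iso F leaf leaf :=
  @Iso F leaf leaf _ _ (star_iso_subproof i j).

(* Image in End(x) of the rebracketing a □ u -> (..(a □ x) □ ..) □ x of u onto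
   an arbitrary tree a; the result does not depend on a. *)
Fixpoint graft_arrow (u : tree) : @iso F leaf leaf :=
  match u with
  | leaf => iso_id _
  | node p q =>
      iso_comp (graft_arrow q)
        (iso_comp (star_iso (graft_arrow p) (iso_id _)) al)
  end.

(* Image in End(x) of the rebracketing of u to the left. *)
Fixpoint left_arrow (u : tree) : @iso F leaf leaf :=
  match u with
  | leaf => iso_id _
  | node p q => iso_comp (graft_arrow q) (star_iso (left_arrow p) (iso_id _))
  end.

Definition WSub_map (u v : W) (_ : hom u v) : @hom (EndX s) tt tt :=
  bwd (left_arrow v) ∘ left_arrow u.

Lemma WSub_map_id (u : W) : WSub_map (idm u) = @idm (EndX s) tt.
Proof. by rewrite /WSub_map bwdK. Qed.

Lemma WSub_map_comp (u v w : W) (g : hom v w) (f : hom u v) :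
  WSub_map (g ∘ f) = WSub_map g ∘ WSub_map f.
Proof.
change (bwd (left_arrow w) ∘ left_arrow u
  = (bwd (left_arrow w) ∘ left_arrow v) ∘ (bwd (left_arrow v) ∘ left_arrow u)).
by rewrite compA -(compA (bwd (left_arrow w))) fwdK comp_idr.
Qed.

Definition WSub : functor W (EndX s) :=
  @Functor W (EndX s) (fun _ => tt) WSub_map WSub_map_id WSub_map_comp.

(* [WSub] is the strict semi-monoidal functor W -> End(x): [WSub_strict] and
   [WSub_unique] below. *)
Definition strict (T : functor W (EndX s)) :=
  (forall (a a' b b' : W) (f : hom a a') (g : hom b b'),
     fmap T (f ⊠ g) = star (fmap T f) (fmap T g)) /\
  (forall a b c : W, fmap T (tau a b c) = al).

Let left_arrow_tens (u v u' v' : tree) : leaves v = leaves v' ->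
  fwd (left_arrow (node u v)) = left_arrow (node u' v')
    ∘ star (bwd (left_arrow u') ∘ left_arrow u)
           (bwd (left_arrow v') ∘ left_arrow v).
Proof.
move=> eqv.
exact (@coherence_tens F leaf (@star C s) al (star_id s) (@star_comp C s)
  (@alpha_natural C s) (alpha_pentagon s) graft_arrow left_arrow
  erefl (fun _ _ => erefl) erefl (fun _ _ => erefl) u v u' v' _ _
  eqv (fwdK _) (fwdK _)).
Qed.

Let left_arrow_assoc (u v w : tree) :
  fwd (left_arrow (node u (node v w))) = left_arrow (node (node u v) w) ∘ al.
Proof.
exact (@coherence_assoc F leaf (@star C s) al (star_id s) (@star_comp C s)
  (@alpha_natural C s) graft_arrow left_arrow
  (fun _ _ => erefl) (fun _ _ => erefl) u v w).
Qed.

Lemma WSub_strict : strict WSub.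
Proof.
split=> [u u' v v' f g|u v w].
  change (bwd (left_arrow (node u' v')) ∘ left_arrow (node u v)
    = star (bwd (left_arrow u') ∘ left_arrow u)
           (bwd (left_arrow v') ∘ left_arrow v)).
  by rewrite (left_arrow_tens u u' g) compA bwdK comp_idl.
change (bwd (left_arrow (node (node u v) w)) ∘ left_arrow (node u (node v w))
  = al).
by rewrite left_arrow_assoc compA bwdK comp_idl.
Qed.

Lemma WSub_unique (T : functor W (EndX s)) : strict T ->
  forall (u v : W) (f : hom u v), fmap T f = fmap WSub f.
Proof.
case=> Ttens Ttau.
pose fix graft (a u : tree) : tree :=
  if u is node p q then graft (graft a p) q else node a u.
pose fix left u : tree := if u is node p q then graft (left p) q else leaf.
have leaves_graft a u : leaves (graft a u) = leaves a + leaves u.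
  by elim: u a => //= p IHp q IHq a; rewrite IHq IHp addnA.
have Tirr (u v : W) (f g : hom u v) : fmap T f = fmap T g.
  by rewrite (eq_irrelevance (f : leaves u = leaves v) g).
have Tid (u : W) (f : hom u u) : fmap T f = one.
  by rewrite (Tirr _ _ f (idm u)) fmap_id.
have Tgraft u : forall (a : W) (f : @hom W (node a u) (graft a u)),
    fmap T f = graft_arrow u.
  elim: u => [|p IHp q IHq] a f; first exact: Tid.
  have g : @hom W (node a p) (graft a p) by exact: esym (leaves_graft _ _).
  have h : @hom W (node (graft a p) q) (graft (graft a p) q).
    exact: esym (leaves_graft _ _).
  rewrite (Tirr _ _ f (h ∘ ((g ⊠ @idm W q) ∘ @tau W a p q))).
  by rewrite !fmap_comp Ttens Ttau IHq IHp Tid.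
have leaves_left u : leaves (left u) = leaves u.
  by elim: u => //= p IHp q _; rewrite leaves_graft IHp.
have Tleft u : forall f : @hom W u (left u), fmap T f = left_arrow u.
  elim: u => [|p IHp q _] f; first exact: Tid.
  have g : @hom W p (left p) by rewrite /= leaves_left.
  have h : @hom W (node (left p) q) (graft (left p) q).
    exact: esym (leaves_graft _ _).
  rewrite (Tirr _ _ f (h ∘ (g ⊠ @idm W q))).
  by rewrite fmap_comp Ttens Tgraft IHp Tid.
move=> u v f /=; rewrite /WSub_map.
have g : @hom W v (left v) by rewrite /= leaves_left.
have same : left u = left v.
  have graft_comb w : forall n, graft (left_tree n) w = left_tree (n + leaves w).
    by elim: w => [|p IHp q IHq] n /=; rewrite ?addn1 // IHp IHq addnA.
  have left_comb w : left w = left_tree (leaves w).-1.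
    elim: w => //= p -> q _; rewrite graft_comb; congr left_tree.
    have : 0 < leaves p by elim: (p) => //= p1 IH1 p2 _; rewrite addn_gt0 IH1.
    by case: (leaves p).
  by rewrite !left_comb f.
have h : fmap T g ∘ fmap T f = left_arrow u.
  rewrite -fmap_comp; move: (g ∘ f); rewrite -same => k.
  exact: Tleft.
by rewrite -[LHS](@comp_idl F) -(bwdK (left_arrow v)) -compA -(Tleft v g) -h.
Qed.

End Substitution.

(* [dimage] keeps the underlying graph, so P has the same graph as E. *)
Definition guaranteed_by_coherence (C : semi_monoidal) (s : self_similar C)
  (E : diagram (EndX s)) :=
  exists P : diagram W, E = dimage (WSub s) P.

(* Main.v *)
From mathcomp Require Import ssreflect ssrfun ssrbool eqtype ssrnat.
From Stdlib Require Import FunctionalExtensionality.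
Require Import Defs.

Set Implicit Arguments.
Unset Strict Implicit.
Unset Printing Implicit Defensive.

(** Conjugation by the code isomorphisms is injective on each hom-set, so [Phi]
is faithful and a diagram over F_S commutes as soon as its image in End(x)
does.  Two diagrams are self-similarity equivalent exactly when they have the
same image under [Phi], up to an isomorphism of graphs.  Both conditions of
the theorem are therefore statements about [Phi D], and both amount to this
one: the vertices can be labelled by trees in such a way that every edge of
[Phi D] is the image under [WSub] of an arrow of W between the labels of its
ends ([guaranteed_labelling], [ss_canonical_labelling]).  For condition 2 the
labels are the objects of the diagram over W; for condition 1 they are the
objects of the canonical diagram T.

The second identification rests on two facts.  [Phi] and [WSub] both turn the
tensor into [star] and the associator into [alpha], so that they agree on
every arrow built from associators ([Phi_canonical]).  Conversely any two
trees with as many leaves are joined by such an arrow, because each of them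
can be rebracketed to the left comb ([canonical_connected]); this provides the
edges of T once its vertices are chosen.

Given a labelling, D commutes because every composite along a path of [Phi D]
is the image of the only arrow of W between the labels of its end points. *)

(** * Categorical preliminaries *)

Lemma inverse_arrows_sym (A : category) (a b : A) (f : hom a b) (g : hom b a) :
  inverse_arrows f g -> inverse_arrows g f.
Proof. by case=> gf fg; split. Qed.

Lemma inverse_arrows_uniq (A : category) (a b : A) (f : hom a b)
    (g g' : hom b a) :
  inverse_arrows f g -> inverse_arrows f g' -> g = g'.
Proof.
case=> gf _ [_ fg'].
by rewrite -[LHS]comp_idr -fg' compA gf comp_idl.
Qed.

Lemma inverse_arrows_map (A B : category) (F : functor A B) (a b : A)
    (f : hom a b) (g : hom b a) :
  inverse_arrows f g -> inverse_arrows (fmap F f) (fmap F g).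
Proof. by case=> gf fg; split; rewrite -fmap_comp ?gf ?fg fmap_id. Qed.

Lemma path_comp_dimage (A B : category) (F : functor A B) (D : diagram A)
    (v w : D) (p : dpath v w) :
  @path_comp B (dimage F D) v w p = fmap F (path_comp p).
Proof.
elim: p => [u|u u' w' e q IHq] /=; first by rewrite fmap_id.
by rewrite IHq fmap_comp.
Qed.

Lemma faithful_commutes (A B : category) (F : functor A B) (D : diagram A) :
  (forall (a b : A) (f g : hom a b), fmap F f = fmap F g -> f = g) ->
  commutes (dimage F D) -> commutes D.
Proof.
move=> F_inj FD_comm v w p q; apply: F_inj.
by rewrite -!path_comp_dimage; apply: FD_comm.
Qed.

(** * Canonical arrows between trees *)

(** Asking for an isomorphism, rather than an arrow, makes the relation
symmetric at once, through the closure of canonical arrows under inverses. *)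
Definition canonically_isomorphic (C : semi_monoidal) (a b : C) :=
  exists i : iso a b, canonical_arrow i.

Lemma canonically_isomorphic_refl (C : semi_monoidal) (a : C) :
  canonically_isomorphic a a.
Proof. by exists (iso_id a); apply: can_id. Qed.

Lemma canonically_isomorphic_sym (C : semi_monoidal) (a b : C) :
  canonically_isomorphic a b -> canonically_isomorphic b a.
Proof.
case=> i can_i; exists (Iso (inverse_arrows_sym (isoP i))).
exact: can_inv (isoP i) can_i.
Qed.

Lemma canonically_isomorphic_trans (C : semi_monoidal) (a b c : C) :
  canonically_isomorphic a b -> canonically_isomorphic b c ->
  canonically_isomorphic a c.
Proof.
by case=> i can_i [j can_j]; exists (iso_comp j i); apply: can_comp.
Qed.

Lemma canonically_isomorphic_tens (C : semi_monoidal) (a a' b b' : C) :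
  canonically_isomorphic a a' -> canonically_isomorphic b b' ->
  canonically_isomorphic (a ⊗ b) (a' ⊗ b').
Proof.
by case=> i can_i [j can_j]; exists (iso_tens i j); apply: can_tens.
Qed.

Lemma canonically_isomorphic_tau (C : semi_monoidal) (a b c : C) :
  canonically_isomorphic (a ⊗ (b ⊗ c)) ((a ⊗ b) ⊗ c).
Proof. by exists (tau a b c); apply: can_tau. Qed.

Section TreeRebracketing.

Variables (C : semi_monoidal) (S : C).

Local Notation F := (FS S).

(** The leaves of [u] are moved one by one onto the comb at its left; the
induction needs a comb of arbitrary length there. *)
Lemma comb_graft (u : tree) (n : nat) :
  @canonically_isomorphic F (node (left_tree n) u) (left_tree (n + leaves u)).
Proof.
elim: u n => [|p IHp q IHq] n.
  by rewrite /= addn1; apply: canonically_isomorphic_refl.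
apply: canonically_isomorphic_trans (@canonically_isomorphic_tau F _ _ _) _.
rewrite /= addnA; apply: canonically_isomorphic_trans (IHq _).
exact: (@canonically_isomorphic_tens F _ _ _ _ (IHp n)
          (canonically_isomorphic_refl _)).
Qed.

Lemma leaves_gt0 (u : tree) : 0 < leaves u.
Proof. by elim: u => //= p IHp q _; rewrite addn_gt0 IHp. Qed.

(** [left_tree n] has [n.+1] leaves, hence the predecessor. *)
Lemma canonical_left_tree (u : tree) :
  @canonically_isomorphic F u (left_tree (leaves u).-1).
Proof.
elim: u => [|p IHp q _]; first exact: canonically_isomorphic_refl.
have -> : (leaves (node p q)).-1 = (leaves p).-1 + leaves q.
  by rewrite /=; case: (leaves p) (leaves_gt0 p).
apply: canonically_isomorphic_trans (comb_graft _ _).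
exact: (@canonically_isomorphic_tens F _ _ _ _ IHp
          (canonically_isomorphic_refl _)).
Qed.

(** Both trees are rebracketed to the same left comb. *)
Lemma canonical_connected (u v : tree) :
  leaves u = leaves v -> @canonically_isomorphic F u v.
Proof.
move=> eq_uv; apply: canonically_isomorphic_trans (canonical_left_tree u) _.
by rewrite eq_uv; apply: canonically_isomorphic_sym (canonical_left_tree v).
Qed.

End TreeRebracketing.

(** * The functor to the endomorphism monoid *)

Section PhiImage.

Variables (C : semi_monoidal) (s : self_similar C).

Local Notation F := (FS (ss_ob s)).

Lemma Phi_mapK (a b : F) (f : hom a b) :
  bwd (code s b) ∘ Phi_map f ∘ code s a = f.
Proof.
rewrite /Phi_map !compA bwdK comp_idl.
by rewrite -compA bwdK comp_idr.
Qed.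

Lemma decodeK (a b : F) (h : @hom F leaf leaf) :
  Phi_map (bwd (code s b) ∘ h ∘ code s a : @hom F a b) = h.
Proof.
by rewrite /Phi_map !compA fwdK comp_idl -compA fwdK comp_idr.
Qed.

Lemma Phi_map_inj (a b : F) (f g : hom a b) : Phi_map f = Phi_map g -> f = g.
Proof. by move=> eq_fg; rewrite -(Phi_mapK f) eq_fg Phi_mapK. Qed.

Lemma Phi_code (a : F) : Phi_map (fwd (code s a)) = @idm F leaf.
Proof. by rewrite /Phi_map comp_idl fwdK. Qed.

(** The squares defining self-similarity equivalence are those in which [Phi]
identifies [f] and [g]: the two remaining sides are composites of code
isomorphisms, which become identities. *)
Lemma ss_square_Phi (a b c d : F) (f : hom a b) (g : hom c d) :
  f ∘ (bwd (code s a) ∘ code s c) = bwd (code s b) ∘ code s d ∘ g <->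
  Phi_map f = Phi_map g.
Proof.
split=> [sq | eq_fg].
  have : code s b ∘ (f ∘ (bwd (code s a) ∘ code s c)) ∘ bwd (code s c)
       = code s b ∘ (bwd (code s b) ∘ code s d ∘ g) ∘ bwd (code s c).
    by rewrite sq.
  by rewrite !compA fwdK comp_idl -(compA _ (code s c)) fwdK comp_idr.
rewrite -(Phi_mapK f) eq_fg /Phi_map !compA.
rewrite -(compA _ (code s a)) fwdK comp_idr.
by rewrite -(compA _ (bwd (code s c))) bwdK comp_idr.
Qed.

(** Under [Phi] a tensor becomes a [star], an associator becomes [alpha] and a
code isomorphism becomes an identity; endomorphisms of the leaf, hence the
generators [star] and [alpha], are left as they are. *)
Lemma Phi_code_canonical (a b : F) (f : hom a b) :
  code_canonical_arrow f -> @canonical_arrow (EndX s) tt tt (Phi_map f).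
Proof.
have can_alpha : @canonical_arrow (EndX s) tt tt (fwd (alpha s)).
  exact: (@can_tau (EndX s) tt tt tt).
elim=> {a b f} [a|a b c g f _ can_g _ can_f|a a' b b' f g _ can_f _ can_g
  |a b c|a|f g _ can_f _ can_g||a b f g fg _ can_f].
- by rewrite Phi_map_id; apply: (@can_id (EndX s) tt).
- by rewrite Phi_map_comp; apply: (@can_comp (EndX s) tt tt tt).
- by rewrite Phi_tens; apply: (@can_tens (EndX s) tt tt tt tt).
- by rewrite Phi_tau.
- by rewrite Phi_code; apply: (@can_id (EndX s) tt).
- rewrite Phi_leaf -(Phi_leaf f) -(Phi_leaf g).
  exact: (@can_tens (EndX s) tt tt tt tt).
- by rewrite Phi_leaf.
- apply: (@can_inv (EndX s) tt tt) can_f.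
  exact: (inverse_arrows_map (Phi s) fg).
Qed.

(** Both [Phi] and [WSub] are strict, so they agree on everything generated by
associators. *)
Lemma Phi_canonical (a b : F) (f : hom a b) :
  canonical_arrow f -> exists g : @hom W a b, Phi_map f = fmap (WSub s) g.
Proof.
have [WSub_tens WSub_tau] := WSub_strict s.
elim=> {a b f} [a|a b c g f _ [g' Eg] _ [f' Ef]
  |a a' b b' f g _ [f' Ef] _ [g' Eg]|a b c|a b f g fg _ [f' Ef]].
- by exists (@idm W a); rewrite Phi_map_id fmap_id.
- by exists (@hcomp W _ _ _ g' f'); rewrite Phi_map_comp fmap_comp Ef Eg.
- by exists (@tensm W _ _ _ _ f' g'); rewrite Phi_tens WSub_tens Ef Eg.
- by exists (fwd (@tau W a b c)); rewrite Phi_tau WSub_tau.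
- have inv_f' : @inverse_arrows W a b f' (esym f').
    by split; apply: eq_irrelevance.
  exists (esym f'); apply: (@inverse_arrows_uniq (EndX s) tt tt (Phi_map f)).
    exact: (inverse_arrows_map (Phi s) fg).
  by rewrite Ef; apply: (inverse_arrows_map (WSub s) inv_f').
Qed.

(** Conversely, every value of [WSub] is [Phi] of a canonical arrow, which is
the decoding of that value since [Phi] is conjugation. *)
Lemma canonical_decode (a b : F) (g : @hom W a b) :
  canonical_arrow
    (bwd (code s b) ∘ fmap (WSub s) g ∘ code s a : @hom F a b).
Proof.
have [i can_i] := canonical_connected (ss_ob s) g.
have [g' Ei] := Phi_canonical can_i.
have -> : fmap (WSub s) g = Phi_map i by rewrite Ei.
by rewrite Phi_mapK.
Qed.

End PhiImage.

(** * Labelling a diagram by trees *)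

Section Labellings.

Variables (C : semi_monoidal) (s : self_similar C).

Local Notation F := (FS (ss_ob s)).

(** Stated for an arbitrary diagram over End(x), so that an equation between
two diagrams transports it without transport of vertices or edges. *)
Definition coherence_labelling (E : diagram (EndX s)) (l : E -> W) :=
  forall (v w : E) (e : edge v w),
  exists g : hom (l v) (l w), darr E e = fmap (WSub s) g.

Lemma guaranteed_labelling (D : diagram F) :
  guaranteed_by_coherence (dimage (Phi s) D) <->
  exists l, @coherence_labelling (dimage (Phi s) D) l.
Proof.
split=> [[P ->] | [l lab]].
  by exists (dob P) => v w e; exists (darr P e).
have arr (v w : D) (e : edge v w) : leaves (l v) = leaves (l w) by case: (lab v w e).
exists (@Diagram W (shape D) l arr); rewrite /dimage /=; congr Diagram.
apply: functional_extensionality_dep => v.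
apply: functional_extensionality_dep => w.
apply: functional_extensionality_dep => e.
by have [g /= ->] := lab v w e.
Qed.

Lemma digraph_iso_id_subproof (G : digraph) : bijective (@id G).
Proof. by exists id. Qed.

Definition digraph_iso_id (G : digraph) : digraph_iso G G :=
  @DigraphIso G G id (fun v w e => e) (digraph_iso_id_subproof G)
    (fun v w => Bijective (fun _ => erefl) (fun _ => erefl)).

Lemma ss_canonical_labelling (D : diagram F) :
  (exists T : diagram F, ss_equiv D T /\ canonical T) <->
  exists l, @coherence_labelling (dimage (Phi s) D) l.
Proof.
split=> [[T [[eta sq] can_T]] | [l lab]].
  exists (fun v => dob T (eta v)) => v w e.
  have [g Eg] := Phi_canonical (can_T _ _ (iso_edge eta e)).
  by exists g; rewrite -Eg; apply/ss_square_Phi/sq.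
(* The edges of T are forced: each must have the same image as that of D. *)
pose T := @Diagram F (shape D) l (fun v w e =>
  bwd (code s (l w)) ∘ Phi_map (darr D e) ∘ code s (l v)).
exists T; split.
  exists (digraph_iso_id D) => v w e; apply/ss_square_Phi.
  by rewrite /= decodeK.
move=> v w e /=; have [g /= ->] := lab v w e.
exact: canonical_decode.
Qed.

Lemma labelling_path (E : diagram (EndX s)) (l : E -> W) (v w : E)
    (p : dpath v w) :
  coherence_labelling l ->
  exists g : hom (l v) (l w), path_comp p = fmap (WSub s) g.
Proof.
move=> lab; elim: p => [u|u u' w' e q [g Eg]] /=.
  by exists (@idm W (l u)); exact: esym (fmap_id (WSub s) _).
have [h Eh] := lab _ _ e.
exists (@hcomp W _ _ _ g h).
by rewrite Eg Eh; exact: esym (fmap_comp (WSub s) _ _).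
Qed.

Lemma labelling_commutes (E : diagram (EndX s)) (l : E -> W) :
  coherence_labelling l -> commutes E.
Proof.
move=> lab v w p q.
have [[g ->] [h ->]] := (labelling_path p lab, labelling_path q lab).
by rewrite (eq_irrelevance (g : leaves _ = leaves _) h).
Qed.

End Labellings.

Theorem theorem8p5 (C : semi_monoidal) (C_faithful : forall a : C, faithful_object a)
    (s : self_similar C) (D : diagram (FS (ss_ob s))) (D_can : code_canonical D) :
  canonical (dimage (Phi s) D : diagram (EndX s)) /\
  ((exists T : diagram (FS (ss_ob s)), ss_equiv D T /\ canonical T) <->
   guaranteed_by_coherence (dimage (Phi s) D)) /\
  ((exists T : diagram (FS (ss_ob s)), ss_equiv D T /\ canonical T) ->
   commutes D).
Proof.
split; first by move=> v w e; apply/Phi_code_canonical/D_can.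
split.
  exact: iff_trans (ss_canonical_labelling D)
    (iff_sym (guaranteed_labelling D)).
case/ss_canonical_labelling=> l /labelling_commutes.
by apply: faithful_commutes; apply: Phi_map_inj.
Qed.
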